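(* $$\frac{9\pi^2}{4} = \sum_{k=0}^{\infty}\left(\frac1{64}\right)^{k}\frac{\left(\frac12\right)_k(1)_k(1)_k(1)_k}{\left(\frac54\right)_k\left(\frac54\right)_k\left(\frac74\right)_k\left(\frac74\right)_k}\,\left(42k^2+61k+22\right).$$
   Context: For $k\in\mathbb{N}_0$, $(\alpha)_k=\alpha(\alpha+1)\cdots(\alpha+k-1)$ is the rising factorial (Pochhammer symbol), with $(\alpha)_0=1$. *)

(* Defs.v *)
From Stdlib Require Import Reals.
From Coquelicot Require Import Coquelicot.
Open Scope R_scope.

Fixpoint pochhammer (a : R) (k : nat) : R :=
  match k with
  | O => 1
  | S j => pochhammer a j * (a + INR j)
  end.

(* Main.v *)
(** WZ method.  Writing [x = 2n+k+3/2], the function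
    [F(n,k) = n!^4/(2n)! * ((1/2)_{n+k} / (3/2)_{2n+k})^2] has a WZ mate
    [G(n,k) = F(n,k) q(n,k) / x^2] with [F(n,k) - F(n+1,k) = G(n,k) - G(n,k+1)].
    The [n]-th term of the series is [18 G(n,0)], whereas [F(0,k) = 1/(2k+1)^2].
    Since [F(n,k) <= 2^(-n) F(0,k)] and [G(n,k) -> 0] as [k -> oo], summing the
    relation over a rectangle gives [sum_n G(n,0) = sum_k F(0,k) = PI^2/8].

    The last sum is evaluated as follows.  For [N] a power of two,
    [sum_{k<N} 1/sin^2((2k+1)PI/(4N)) = 2 N^2], because
    [1/sin^2 x + 1/cos^2 x = 4/sin^2(2x)] reduces [2N] to [N]; and
    [1/x^2 <= 1/sin^2 x <= 1/x^2 + 1] on [(0, PI/2)]. *)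

Require Import Defs.
From Stdlib Require Import Reals Lra Lia.
From Coquelicot Require Import Coquelicot.
Open Scope R_scope.

(** * Finite sums *)

(** The index [n] is excluded, unlike in [sum_n], so that empty sums exist and telescoping needs no
    shift. *)
Fixpoint psum (f : nat -> R) (n : nat) : R :=
  match n with
  | O => 0
  | S m => psum f m + f m
  end.

Lemma sum_n_psum (f : nat -> R) (n : nat) : sum_n f n = psum f (S n).
Proof.
  induction n as [|n IH].
  - rewrite sum_O. simpl. ring.
  - rewrite sum_Sn, IH. reflexivity.
Qed.

Lemma psum_ext (f g : nat -> R) (n : nat) :
  (forall k, (k < n)%nat -> f k = g k) -> psum f n = psum g n.
Proof.
  induction n as [|n IH]; intros H; simpl; [reflexivity|].
  rewrite IH, H; [reflexivity | lia | intros k Hk; apply H; lia].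
Qed.

Lemma psum_le (f g : nat -> R) (n : nat) :
  (forall k, (k < n)%nat -> f k <= g k) -> psum f n <= psum g n.
Proof.
  induction n as [|n IH]; intros H; simpl; [lra|].
  apply Rplus_le_compat; [apply IH; intros k Hk|]; apply H; lia.
Qed.

Lemma psum_scal (c : R) (f : nat -> R) (n : nat) :
  psum (fun k => c * f k) n = c * psum f n.
Proof. induction n as [|n IH]; simpl; [|rewrite IH]; ring. Qed.

Lemma psum_plus (f g : nat -> R) (n : nat) :
  psum (fun k => f k + g k) n = psum f n + psum g n.
Proof. induction n as [|n IH]; simpl; [|rewrite IH]; ring. Qed.

Lemma psum_const (c : R) (n : nat) : psum (fun _ => c) n = INR n * c.
Proof. induction n as [|n IH]; [simpl; ring|]. rewrite S_INR. simpl psum. rewrite IH. ring. Qed.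

Lemma psum_telescope (f : nat -> R) (n : nat) :
  psum (fun k => f k - f (S k)) n = f O - f n.
Proof. induction n as [|n IH]; simpl; [|rewrite IH]; ring. Qed.

Lemma psum_S_l (f : nat -> R) (n : nat) :
  psum f (S n) = f O + psum (fun k => f (S k)) n.
Proof.
  induction n as [|n IH]; [simpl; ring|].
  change (psum f (S (S n))) with (psum f (S n) + f (S n)). rewrite IH. simpl. ring.
Qed.

(** Serves to pair each angle [x] with [PI / 2 - x]. The induction peels off both end terms, hence
    needs the hypothesis for the shifted [f]. *)
Lemma psum_fold (n : nat) : forall f : nat -> R,
  psum f (2 * n) = psum (fun k => f k + f (2 * n - 1 - k)%nat) n.
Proof.
  induction n as [|n IH]; intros f; [reflexivity|].
  rewrite (psum_S_l _ n).
  replace (2 * S n)%nat with (S (S (2 * n))) by lia.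
  change (psum f (S (S (2 * n)))) with (psum f (S (2 * n)) + f (S (2 * n))).
  rewrite psum_S_l, IH.
  replace (S (S (2 * n)) - 1 - 0)%nat with (S (2 * n)) by lia.
  rewrite (psum_ext
    (fun k => f (S k) + f (S (S (2 * n)) - 1 - S k)%nat)
    (fun k => f (S k) + f (S (2 * n - 1 - k)))).
  - ring.
  - intros k Hk. do 2 f_equal. lia.
Qed.

Lemma psum_le_index (f : nat -> R) (m n : nat) :
  (forall k, 0 <= f k) -> (m <= n)%nat -> psum f m <= psum f n.
Proof.
  intros Hf Hmn. induction Hmn as [|n _ IH]; [lra|].
  simpl. specialize (Hf n). lra.
Qed.

(** * Sums of inverse squared sines *)

(** [sin y - y * cos y] vanishes at 0 and has derivative [y * sin y >= 0]. *)
Lemma x_cos_le_sin (x : R) : 0 <= x -> x <= PI / 2 -> x * cos x <= sin x.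
Proof.
  intros Hx0 Hx1. destruct (Req_dec x 0) as [->|Hne]; [rewrite sin_0; lra|].
  destruct (MVT_cor2 (fun y => sin y - y * cos y) (fun y => y * sin y) 0 x)
    as [c [Hc [Hc0 Hc1]]]; [lra | |].
  - intros c _. apply is_derive_Reals. auto_derive; [trivial|ring].
  - rewrite sin_0 in Hc.
    assert (0 <= sin c) by (apply sin_ge_0; pose proof PI_RGT_0; lra).
    assert (0 <= c * sin c * (x - 0)) by (apply Rmult_le_pos; [apply Rmult_le_pos|]; lra).
    lra.
Qed.

Lemma inv_sin_sqr_bounds (x : R) : 0 < x -> x < PI / 2 ->
  / x ^ 2 <= / sin x ^ 2 <= / x ^ 2 + 1.
Proof.
  intros Hx0 Hx1.
  assert (Hs : 0 < sin x) by (apply sin_gt_0; lra).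
  assert (Hsx : sin x < x) by (apply sin_lt_x; lra).
  assert (Hc : 0 < cos x) by (apply cos_gt_0; lra).
  pose proof (x_cos_le_sin x (Rlt_le _ _ Hx0) (Rlt_le _ _ Hx1)) as Ht.
  pose proof (sin2_cos2 x) as Hp. unfold Rsqr in Hp.
  split.
  - apply Rinv_le_contravar; nra.
  - assert (Hq : (x * cos x) ^ 2 <= sin x ^ 2)
      by (apply pow_incr; split; [apply Rmult_le_pos; lra | lra]).
    apply Rmult_le_reg_r with (x ^ 2 * sin x ^ 2); [apply Rmult_lt_0_compat; nra|].
    replace (/ sin x ^ 2 * (x ^ 2 * sin x ^ 2)) with (x ^ 2) by (field; lra).
    replace ((/ x ^ 2 + 1) * (x ^ 2 * sin x ^ 2)) with (sin x ^ 2 + x ^ 2 * sin x ^ 2)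
      by (field; lra).
    (* With denominators cleared, [x^2 = x^2 sin^2 x + x^2 cos^2 x], and the last term is at most
       [sin^2 x] by [Hq]. *)
    replace (x ^ 2) with (x ^ 2 * (sin x * sin x + cos x * cos x)) at 1
      by (rewrite Hp; ring).
    nra.
Qed.

Lemma inv_sin_sqr_double (x : R) : 0 < x -> x < PI / 2 ->
  / sin x ^ 2 + / sin (PI / 2 - x) ^ 2 = 4 * / sin (2 * x) ^ 2.
Proof.
  intros Hx0 Hx1.
  assert (Hs : 0 < sin x) by (apply sin_gt_0; lra).
  assert (Hc : 0 < cos x) by (apply cos_gt_0; lra).
  pose proof (sin2_cos2 x) as Hp. unfold Rsqr in Hp.
  rewrite sin_shift. rewrite sin_2a.
  replace (/ sin x ^ 2 + / cos x ^ 2)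
    with ((sin x * sin x + cos x * cos x) / (sin x ^ 2 * cos x ^ 2)) by (field; lra).
  rewrite Hp. field. lra.
Qed.

(** For [k < N], the midpoints of the [N] equal parts of [[0, PI/2]]. *)
Definition odd_angle (N k : nat) : R := (2 * INR k + 1) * PI / (4 * INR N).

Lemma odd_angle_bounds (N k : nat) : (k < N)%nat -> 0 < odd_angle N k < PI / 2.
Proof.
  intros Hk. pose proof PI_RGT_0 as HP.
  assert (HN : INR k + 1 <= INR N) by (rewrite <- S_INR; apply le_INR; lia).
  pose proof (pos_INR k) as Hk0. unfold odd_angle. split.
  - apply Rdiv_lt_0_compat; [apply Rmult_lt_0_compat|]; lra.
  - apply Rmult_lt_reg_r with (4 * INR N); [lra|].
    replace ((2 * INR k + 1) * PI / (4 * INR N) * (4 * INR N))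
      with ((2 * INR k + 1) * PI) by (field; lra).
    nra.
Qed.

(** Reversing the index reflects the angle in [PI / 4], and doubling an angle of level [2 * N] gives
    the angle of level [N] with the same index. *)
Lemma psum_inv_sin_double (N : nat) :
  psum (fun k => / sin (odd_angle (2 * N) k) ^ 2) (2 * N)
  = 4 * psum (fun k => / sin (odd_angle N k) ^ 2) N.
Proof.
  rewrite psum_fold, <- psum_scal. apply psum_ext. intros k Hk.
  assert (HN : 0 < INR N) by (apply lt_0_INR; lia).
  assert (H2 : odd_angle N k = 2 * odd_angle (2 * N) k)
    by (unfold odd_angle; rewrite mult_INR; simpl (INR 2); field; lra).
  assert (Hr : odd_angle (2 * N) (2 * N - 1 - k) = PI / 2 - odd_angle (2 * N) k).
  { unfold odd_angle. rewrite !minus_INR by lia. rewrite mult_INR.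
    simpl (INR 2). simpl (INR 1). field. lra. }
  rewrite H2, Hr. apply inv_sin_sqr_double; apply odd_angle_bounds; lia.
Qed.

Lemma psum_inv_sin_pow2 (m : nat) :
  psum (fun k => / sin (odd_angle (2 ^ m) k) ^ 2) (2 ^ m) = 2 * INR (2 ^ m) ^ 2.
Proof.
  induction m as [|m IH].
  - simpl. unfold odd_angle. simpl.
    replace ((2 * 0 + 1) * PI / (4 * 1)) with (PI / 4) by field.
    rewrite sin_PI4. pose proof (sqrt_sqrt 2 ltac:(lra)) as H2.
    assert (sqrt 2 <> 0) by (intros H0; rewrite H0 in H2; lra).
    replace (1 / sqrt 2 * (1 / sqrt 2 * 1)) with (/ (sqrt 2 * sqrt 2)) by (field; assumption).
    rewrite H2. field.
  - change (2 ^ S m)%nat with (2 * 2 ^ m)%nat.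
    rewrite psum_inv_sin_double, IH, mult_INR. simpl (INR 2). ring.
Qed.

(** * The sum of the inverse odd squares *)

Definition inv_odd_sqr (k : nat) : R := / (2 * INR k + 1) ^ 2.

Lemma inv_odd_sqr_pos (k : nat) : 0 < inv_odd_sqr k.
Proof.
  pose proof (pos_INR k). apply Rinv_0_lt_compat, pow_lt. lra.
Qed.

Lemma psum_inv_odd_sqr_pow2 (m : nat) :
  PI ^ 2 / 8 - PI ^ 2 / 16 * / INR (2 ^ m) <= psum inv_odd_sqr (2 ^ m) <= PI ^ 2 / 8.
Proof.
  set (N := (2 ^ m)%nat). pose proof PI_RGT_0 as HP.
  assert (HN : 0 < INR N) by (apply lt_0_INR; unfold N; apply Nat.neq_0_lt_0, Nat.pow_nonzero; lia).
  (* [c] is the scale between [/ odd_angle N k ^ 2] and [inv_odd_sqr k]; the value [2 * N^2] of the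
     sine sum is [c * PI^2 / 8]. *)
  set (c := 16 * INR N ^ 2 / PI ^ 2).
  assert (Hc : 0 < c) by (unfold c; apply Rdiv_lt_0_compat; nra).
  assert (Hsc : forall k, / odd_angle N k ^ 2 = c * inv_odd_sqr k).
  { intros k. pose proof (pos_INR k). unfold c, inv_odd_sqr, odd_angle. field. lra. }
  pose proof (psum_inv_sin_pow2 m) as HS. fold N in HS.
  assert (Hlo : c * psum inv_odd_sqr N <= 2 * INR N ^ 2).
  { rewrite <- HS, <- psum_scal. apply psum_le. intros k Hk. rewrite <- Hsc.
    apply inv_sin_sqr_bounds; apply odd_angle_bounds; exact Hk. }
  assert (Hhi : 2 * INR N ^ 2 <= c * psum inv_odd_sqr N + INR N).
  { rewrite <- (Rmult_1_r (INR N)) at 2.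
    rewrite <- HS, <- psum_scal, <- psum_const, <- psum_plus.
    apply psum_le. intros k Hk. rewrite <- Hsc.
    apply inv_sin_sqr_bounds; apply odd_angle_bounds; exact Hk. }
  split; apply Rmult_le_reg_l with c; try exact Hc.
  - replace (c * (PI ^ 2 / 8 - PI ^ 2 / 16 * / INR N)) with (2 * INR N ^ 2 - INR N)
      by (unfold c; field; lra). lra.
  - replace (c * (PI ^ 2 / 8)) with (2 * INR N ^ 2) by (unfold c; field; lra). lra.
Qed.

Lemma psum_inv_odd_sqr_le (n : nat) : psum inv_odd_sqr n <= PI ^ 2 / 8.
Proof.
  apply Rle_trans with (psum inv_odd_sqr (2 ^ n)); [|apply psum_inv_odd_sqr_pow2].
  apply psum_le_index; [intros k; apply Rlt_le, inv_odd_sqr_pos|].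
  apply Nat.lt_le_incl, Nat.pow_gt_lin_r. lia.
Qed.

(** Monotone bounded partial sums converge; the limit is identified along the subsequence of powers
    of two. *)
Lemma is_lim_seq_psum_inv_odd_sqr : is_lim_seq (psum inv_odd_sqr) (PI ^ 2 / 8).
Proof.
  destruct (ex_finite_lim_seq_incr (psum inv_odd_sqr) (PI ^ 2 / 8)) as [l Hl].
  - intros n. simpl. pose proof (inv_odd_sqr_pos n). lra.
  - exact psum_inv_odd_sqr_le.
  - assert (Hphi : filterlim (fun m => (2 ^ m)%nat) eventually eventually).
    { apply eventually_subseq. intros m. apply Nat.pow_lt_mono_r; lia. }
    pose proof (is_lim_seq_subseq _ _ _ Hphi Hl) as Hsub.
    assert (Hsq : is_lim_seq (fun m => psum inv_odd_sqr (2 ^ m)) (PI ^ 2 / 8)).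
    { apply (is_lim_seq_le_le
        (fun m => PI ^ 2 / 8 - PI ^ 2 / 16 * / INR (2 ^ m)) _ (fun _ => PI ^ 2 / 8)).
      - exact psum_inv_odd_sqr_pow2.
      - replace (PI ^ 2 / 8) with (PI ^ 2 / 8 - PI ^ 2 / 16 * 0) at 1 by ring.
        apply is_lim_seq_minus'; [apply is_lim_seq_const|].
        apply (is_lim_seq_scal_l _ (PI ^ 2 / 16) 0).
        apply (is_lim_seq_subseq (fun n => / INR n) 0 _ Hphi).
        apply (is_lim_seq_inv INR p_infty); [apply is_lim_seq_INR | discriminate].
      - apply is_lim_seq_const. }
    apply is_lim_seq_unique in Hsub. apply is_lim_seq_unique in Hsq.
    rewrite Hsq in Hsub. rewrite Hsub. exact Hl.
Qed.

(** * The WZ pair *)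

Lemma pochhammer_pos (a : R) (k : nat) : 0 < a -> 0 < pochhammer a k.
Proof.
  intros Ha. induction k as [|k IH]; simpl; [lra|].
  pose proof (pos_INR k). apply Rmult_lt_0_compat; lra.
Qed.

Lemma pochhammer_half_ratio (k : nat) :
  pochhammer (1 / 2) k / pochhammer (3 / 2) k = / (2 * INR k + 1).
Proof.
  induction k as [|k IH]; [simpl; field|].
  pose proof (pos_INR k) as Hk.
  pose proof (pochhammer_pos (3 / 2) k ltac:(lra)) as Hp.
  rewrite S_INR. simpl pochhammer.
  replace (pochhammer (1 / 2) k * (1 / 2 + INR k) / (pochhammer (3 / 2) k * (3 / 2 + INR k)))
    with (pochhammer (1 / 2) k / pochhammer (3 / 2) k * ((1 / 2 + INR k) / (3 / 2 + INR k)))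
    by (field; lra).
  rewrite IH. field. lra.
Qed.

Definition wz_F (n k : nat) : R :=
  pochhammer 1 n ^ 4 / pochhammer 1 (2 * n)
  * (pochhammer (1 / 2) (n + k) / pochhammer (3 / 2) (2 * n + k)) ^ 2.

(* The numerator was found by solving the WZ equation with a cubic ansatz in [k],
   normalised at [k = 0] by the summand of the theorem. *)
Definition wz_cert (n k : R) : R :=
  ((3 * n + 2) * (14 * n + 11) / 8 + (7 * n + 21 / 4) * k
   + (13 * n + 8) / (2 * (2 * n + 1)) * k ^ 2 + k ^ 3 / (2 * n + 1))
  / (2 * n + k + 3 / 2) ^ 2.

Definition wz_G (n k : nat) : R := wz_F n k * wz_cert (INR n) (INR k).

Lemma wz_F_pos (n k : nat) : 0 < wz_F n k.
Proof.
  unfold wz_F. apply Rmult_lt_0_compat;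
    [apply Rdiv_lt_0_compat | apply pow_lt, Rdiv_lt_0_compat];
    try apply pow_lt; apply pochhammer_pos; lra.
Qed.

Lemma wz_F_0_l (k : nat) : wz_F 0 k = inv_odd_sqr k.
Proof.
  unfold wz_F, inv_odd_sqr. simpl (0 + k)%nat. simpl (2 * 0 + k)%nat.
  rewrite pochhammer_half_ratio. simpl (2 * 0)%nat. simpl pochhammer.
  pose proof (pos_INR k). field. lra.
Qed.

(** The factorials contribute [(n+1)^4 / ((2n+1)(2n+2))], where one factor [n+1] cancels. *)
Lemma wz_F_S_l (n k : nat) :
  wz_F (S n) k
  = wz_F n k
    * ((INR n + 1) ^ 3 / (2 * (2 * INR n + 1))
       * ((INR n + INR k + 1 / 2)
          / ((2 * INR n + INR k + 3 / 2) * (2 * INR n + INR k + 5 / 2))) ^ 2).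
Proof.
  unfold wz_F.
  replace (2 * S n + k)%nat with (S (S (2 * n + k))) by lia.
  replace (2 * S n)%nat with (S (S (2 * n))) by lia.
  replace (S n + k)%nat with (S (n + k)) by lia.
  pose proof (pos_INR k) as Hk. pose proof (pos_INR n) as Hn.
  pose proof (pochhammer_pos (3 / 2) (2 * n + k) ltac:(lra)).
  pose proof (pochhammer_pos 1 (2 * n) ltac:(lra)).
  cbn [pochhammer]. rewrite !S_INR, !plus_INR, !mult_INR. simpl (INR 2).
  field. lra.
Qed.

Lemma wz_F_S_r (n k : nat) :
  wz_F n (S k)
  = wz_F n k * ((INR n + INR k + 1 / 2) / (2 * INR n + INR k + 3 / 2)) ^ 2.
Proof.
  unfold wz_F. rewrite !Nat.add_succ_r.
  pose proof (pos_INR k) as Hk. pose proof (pos_INR n) as Hn.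
  pose proof (pochhammer_pos (3 / 2) (2 * n + k) ltac:(lra)).
  pose proof (pochhammer_pos 1 (2 * n) ltac:(lra)).
  cbn [pochhammer]. rewrite !plus_INR, !mult_INR. simpl (INR 2).
  field. lra.
Qed.

(** Both shift quotients of [wz_F] are rational, so what remains is a rational identity in [n] and
    [k], settled by [field]. *)
Lemma wz_pair (n k : nat) :
  wz_F n k - wz_F (S n) k = wz_G n k - wz_G n (S k).
Proof.
  unfold wz_G, wz_cert. rewrite wz_F_S_l, wz_F_S_r, S_INR.
  pose proof (pos_INR k) as Hk. pose proof (pos_INR n) as Hn.
  field. lra.
Qed.

(** * Summation over a rectangle and estimates *)

Lemma psum_wz_F_sub (n K : nat) :
  psum (wz_F n) K - psum (wz_F (S n)) K = wz_G n 0 - wz_G n K.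
Proof.
  rewrite <- (psum_telescope (wz_G n)).
  rewrite <- (psum_ext _ _ K (fun k _ => wz_pair n k)).
  induction K as [|K IH]; simpl; lra.
Qed.

(** The WZ relation summed over [n < N], [k < K] telescopes in both directions and leaves the four
    sides of the rectangle. *)
Lemma psum_wz_G (N K : nat) :
  psum (fun n => wz_G n 0) N
  = psum inv_odd_sqr K - psum (wz_F N) K + psum (fun n => wz_G n K) N.
Proof.
  rewrite <- (psum_ext _ _ K (fun k _ => wz_F_0_l k)).
  induction N as [|N IH]; simpl; [lra|].
  rewrite IH. pose proof (psum_wz_F_sub N K). lra.
Qed.

Lemma wz_F_le_half (n k : nat) : wz_F (S n) k <= / 2 * wz_F n k.
Proof.
  rewrite wz_F_S_l, (Rmult_comm (/ 2)).
  apply Rmult_le_compat_l; [apply Rlt_le, wz_F_pos|].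
  pose proof (pos_INR k) as Hk. pose proof (pos_INR n) as Hn.
  set (a := INR n) in *. set (b := INR k) in *.
  (* This removes [k]: [a + b + 1/2 <= 2a + b + 3/2] and [2a + 5/2 <= 2a + b + 5/2]. *)
  assert (H1 : 0 <= (a + b + 1 / 2) / ((2 * a + b + 3 / 2) * (2 * a + b + 5 / 2))
               <= / (2 * a + 5 / 2)).
  { split; [apply Rlt_le, Rdiv_lt_0_compat; nra|].
    apply Rmult_le_reg_r with ((2 * a + b + 3 / 2) * (2 * a + b + 5 / 2) * (2 * a + 5 / 2));
      [repeat apply Rmult_lt_0_compat; lra|].
    replace ((a + b + 1 / 2) / ((2 * a + b + 3 / 2) * (2 * a + b + 5 / 2))
             * ((2 * a + b + 3 / 2) * (2 * a + b + 5 / 2) * (2 * a + 5 / 2)))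
      with ((a + b + 1 / 2) * (2 * a + 5 / 2)) by (field; lra).
    replace (/ (2 * a + 5 / 2)
             * ((2 * a + b + 3 / 2) * (2 * a + b + 5 / 2) * (2 * a + 5 / 2)))
      with ((2 * a + b + 3 / 2) * (2 * a + b + 5 / 2)) by (field; lra).
    apply Rmult_le_compat; lra. }
  apply Rle_trans with ((a + 1) ^ 3 / (2 * (2 * a + 1)) * (/ (2 * a + 5 / 2)) ^ 2).
  - apply Rmult_le_compat_l; [|apply pow_incr, H1].
    apply Rlt_le, Rdiv_lt_0_compat; [apply pow_lt|]; lra.
  - apply Rmult_le_reg_r with (2 * (2 * a + 1) * (2 * a + 5 / 2) ^ 2);
      [apply Rmult_lt_0_compat; [|apply pow_lt]; lra|].
    replace ((a + 1) ^ 3 / (2 * (2 * a + 1)) * (/ (2 * a + 5 / 2)) ^ 2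
             * (2 * (2 * a + 1) * (2 * a + 5 / 2) ^ 2)) with ((a + 1) ^ 3) by (field; lra).
    assert (0 <= a ^ 2) by nra. assert (0 <= a ^ 3) by (apply pow_le; lra). nra.
Qed.

Lemma wz_F_le_geom (n k : nat) : wz_F n k <= (1 / 2) ^ n * inv_odd_sqr k.
Proof.
  induction n as [|n IH]; [rewrite wz_F_0_l; simpl; lra|].
  pose proof (wz_F_le_half n k). simpl. lra.
Qed.

Lemma psum_wz_F_bounds (n K : nat) :
  0 <= psum (wz_F n) K <= (1 / 2) ^ n * (PI ^ 2 / 8).
Proof.
  split.
  - replace 0 with (psum (fun _ => 0) K) by (rewrite psum_const; ring).
    apply psum_le. intros k _. apply Rlt_le, wz_F_pos.
  - apply Rle_trans with ((1 / 2) ^ n * psum inv_odd_sqr K).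
    + rewrite <- psum_scal. apply psum_le. intros k _. apply wz_F_le_geom.
    + apply Rmult_le_compat_l; [apply pow_le; lra | apply psum_inv_odd_sqr_le].
Qed.

(** [wz_F] and [/ x^2] are each at most [/ (k+1)^2], while the numerator of the certificate is cubic
    in [k]. The polynomial in [n] is a crude majorant; only the decay in [k] for fixed [n]
    matters. *)
Lemma wz_G_bounds (n k : nat) :
  0 <= wz_G n k <= (42 * INR n ^ 2 + 70 * INR n + 40) * / INR (S k).
Proof.
  pose proof (pos_INR k) as Hk. pose proof (pos_INR n) as Hn.
  unfold wz_G, wz_cert. rewrite S_INR.
  pose proof (wz_F_pos n k) as HF0.
  assert (HF1 : wz_F n k <= / (INR k + 1) ^ 2).
  { apply Rle_trans with (inv_odd_sqr k).
    - apply Rle_trans with (1 := wz_F_le_geom n k).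
      pose proof (inv_odd_sqr_pos k).
      pose proof (pow_incr (1 / 2) 1 n ltac:(lra)) as Hpow. rewrite pow1 in Hpow.
      nra.
    - apply Rinv_le_contravar; [apply pow_lt | apply pow_incr]; lra. }
  set (a := INR n) in *. set (b := INR k) in *.
  assert (H1 : 0 <= (13 * a + 8) / (2 * (2 * a + 1)) <= 8).
  { split; [apply Rlt_le, Rdiv_lt_0_compat; lra|].
    apply Rmult_le_reg_r with (2 * (2 * a + 1)); [lra|].
    replace ((13 * a + 8) / (2 * (2 * a + 1)) * (2 * (2 * a + 1))) with (13 * a + 8)
      by (field; lra). lra. }
  assert (H2 : 0 <= / (2 * a + 1) <= 1).
  { split; [apply Rlt_le, Rinv_0_lt_compat; lra|].
    rewrite <- Rinv_1. apply Rinv_le_contravar; lra. }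
  set (c2 := (13 * a + 8) / (2 * (2 * a + 1))) in *. set (c3 := / (2 * a + 1)) in *.
  set (q := (3 * a + 2) * (14 * a + 11) / 8 + (7 * a + 21 / 4) * b + c2 * b ^ 2 + b ^ 3 * c3).
  assert (Hb2 : 0 <= b ^ 2) by nra. assert (Hb3 : 0 <= b ^ 3) by (apply pow_le; lra).
  set (C := 42 * a ^ 2 + 70 * a + 40).
  assert (Ha2 : 0 <= a ^ 2) by nra.
  assert (Hq : 0 <= q <= C * (b + 1) ^ 3).
  { assert (0 <= c2 * b ^ 2 <= 8 * b ^ 2) by nra.
    assert (0 <= b ^ 3 * c3 <= b ^ 3) by nra.
    assert (0 <= a * b) by nra.
    unfold q, C. split; [nra|].
    replace ((b + 1) ^ 3) with (b ^ 3 + 3 * b ^ 2 + 3 * b + 1) by ring.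
    assert (0 <= (42 * a ^ 2 + 70 * a) * (b ^ 3 + 3 * b ^ 2)) by (apply Rmult_le_pos; nra).
    assert (0 <= a ^ 2 * b) by nra.
    nra. }
  assert (Hx : 0 <= / (2 * a + b + 3 / 2) ^ 2 <= / (b + 1) ^ 2).
  { split; [apply Rlt_le, Rinv_0_lt_compat, pow_lt; lra|].
    apply Rinv_le_contravar; [apply pow_lt | apply pow_incr]; lra. }
  (* Divisions become products with inverses, exposing the factor [q]. *)
  change (0 <= wz_F n k * (((3 * a + 2) * (14 * a + 11) / 8 + (7 * a + 21 / 4) * b
            + c2 * b ^ 2 + b ^ 3 * c3) * / (2 * a + b + 3 / 2) ^ 2) <= C * / (b + 1)).
  fold q. split.
  - apply Rmult_le_pos; [lra|]. apply Rmult_le_pos; lra.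
  - replace (C * / (b + 1))
      with (/ (b + 1) ^ 2 * (C * (b + 1) ^ 3 * / (b + 1) ^ 2)) by (field; lra).
    apply Rmult_le_compat; try lra.
    + apply Rmult_le_pos; lra.
    + apply Rmult_le_compat; lra.
Qed.

Lemma is_lim_seq_wz_G (n : nat) : is_lim_seq (wz_G n) 0.
Proof.
  apply (is_lim_seq_le_le (fun _ => 0) _
    (fun k => (42 * INR n ^ 2 + 70 * INR n + 40) * / INR (S k))).
  - exact (wz_G_bounds n).
  - apply is_lim_seq_const.
  - replace 0 with ((42 * INR n ^ 2 + 70 * INR n + 40) * 0) by ring.
    apply (is_lim_seq_scal_l _ _ 0).
    apply (is_lim_seq_incr_1 (fun k => / INR k)).
    apply (is_lim_seq_inv INR p_infty); [apply is_lim_seq_INR | discriminate].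
Qed.

(** * Passage to the limit *)

Lemma is_lim_seq_psum (f : nat -> nat -> R) (l : nat -> R) (N : nat) :
  (forall n, is_lim_seq (f n) (l n)) ->
  is_lim_seq (fun K => psum (fun n => f n K) N) (psum l N).
Proof.
  intros H. induction N as [|N IH]; simpl; [apply is_lim_seq_const|].
  apply is_lim_seq_plus'; [exact IH | apply H].
Qed.

Lemma psum_wz_G_bounds (N : nat) :
  PI ^ 2 / 8 - (1 / 2) ^ N * (PI ^ 2 / 8) <= psum (fun n => wz_G n 0) N <= PI ^ 2 / 8.
Proof.
  assert (HG : is_lim_seq (fun K => psum (fun n => wz_G n K) N) 0).
  { replace 0 with (psum (fun _ => 0) N) by (rewrite psum_const; ring).
    apply is_lim_seq_psum, is_lim_seq_wz_G. }
  set (S := psum (fun n => wz_G n 0) N).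
  assert (HL : is_lim_seq (fun K => psum inv_odd_sqr K + psum (fun n => wz_G n K) N)
                 (PI ^ 2 / 8)).
  { replace (PI ^ 2 / 8) with (PI ^ 2 / 8 + 0) by ring.
    apply is_lim_seq_plus'; [exact is_lim_seq_psum_inv_odd_sqr | exact HG]. }
  split.
  - cut (PI ^ 2 / 8 <= S + (1 / 2) ^ N * (PI ^ 2 / 8)); [lra|].
    refine (is_lim_seq_le _ _ _ _ _ HL (is_lim_seq_const _)).
    intros K. simpl. pose proof (psum_wz_G N K) as HS. fold S in HS.
    pose proof (psum_wz_F_bounds N K). lra.
  - refine (is_lim_seq_le _ _ _ _ _ (is_lim_seq_const S) HL).
    intros K. simpl. pose proof (psum_wz_G N K) as HS. fold S in HS.
    pose proof (psum_wz_F_bounds N K). lra.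
Qed.

Lemma is_series_wz_G : is_series (fun n => wz_G n 0) (PI ^ 2 / 8).
Proof.
  change (is_lim_seq (sum_n (fun n => wz_G n 0)) (PI ^ 2 / 8)).
  (* [sum_n] up to [N] has [N + 1] terms, hence the shift. *)
  apply (is_lim_seq_ext (fun N => psum (fun n => wz_G n 0) (S N)));
    [intros N; symmetry; apply sum_n_psum|].
  apply (is_lim_seq_incr_1 (psum (fun n => wz_G n 0))).
  apply (is_lim_seq_le_le (fun N => PI ^ 2 / 8 - (1 / 2) ^ N * (PI ^ 2 / 8)) _
    (fun _ => PI ^ 2 / 8)).
  - exact psum_wz_G_bounds.
  - replace (PI ^ 2 / 8) with (PI ^ 2 / 8 - 0 * (PI ^ 2 / 8)) at 1 by ring.
    apply is_lim_seq_minus'; [apply is_lim_seq_const|].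
    apply (is_lim_seq_scal_r _ (PI ^ 2 / 8) 0).
    apply is_lim_seq_geom. rewrite Rabs_pos_eq; lra.
  - apply is_lim_seq_const.
Qed.

(** * Identification with the summand *)

(** Behind this are [(2n)! = 4^n (1/2)_n n!] and [(3/2)_{2n} = 4^n (3/4)_n (5/4)_n]; the factor
    [9 / (4n+3)^2] turns [(3/4)_n] into [(7/4)_n], squared. The proof compares consecutive terms. *)
Lemma wz_F_0_r (n : nat) :
  wz_F n 0 * (9 / (4 * INR n + 3) ^ 2)
  = (1 / 64) ^ n
    * ((pochhammer (1 / 2) n * pochhammer 1 n * pochhammer 1 n * pochhammer 1 n)
       / (pochhammer (5 / 4) n * pochhammer (5 / 4) n
          * pochhammer (7 / 4) n * pochhammer (7 / 4) n)).
Proof.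
  induction n as [|n IH]; [unfold wz_F; simpl; field|].
  rewrite wz_F_S_l, S_INR. simpl (INR 0).
  pose proof (pos_INR n) as Hn.
  pose proof (pochhammer_pos (5 / 4) n ltac:(lra)).
  pose proof (pochhammer_pos (7 / 4) n ltac:(lra)).
  replace (wz_F n 0) with
    (wz_F n 0 * (9 / (4 * INR n + 3) ^ 2) * ((4 * INR n + 3) ^ 2 / 9)) by (field; lra).
  rewrite IH. cbn [pochhammer pow]. field. lra.
Qed.

Theorem mainTheorem20 :
  is_series
    (fun k : nat =>
       (1 / 64) ^ k
       * ((pochhammer (1 / 2) k * pochhammer 1 k * pochhammer 1 k * pochhammer 1 k)
          / (pochhammer (5 / 4) k * pochhammer (5 / 4) k
             * pochhammer (7 / 4) k * pochhammer (7 / 4) k))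
       * (42 * INR k ^ 2 + 61 * INR k + 22))
    (9 * PI ^ 2 / 4).
Proof.
  replace (9 * PI ^ 2 / 4) with (18 * (PI ^ 2 / 8)) by field.
  apply (is_series_ext (fun n => 18 * wz_G n 0)).
  (* At [k = 0] the numerator of the certificate is [(3n+2)(14n+11)/8], and
     [(3n+2)(14n+11) = 42n^2 + 61n + 22]. *)
  - intros n. rewrite <- wz_F_0_r. unfold wz_G, wz_cert. simpl (INR 0).
    (* The equality is restated over [R] itself, as [field] requires, instead of the carrier of a
       normed module. *)
    pose proof (pos_INR n). match goal with |- ?x = ?y => change (@eq R x y) end. field. lra.
  - apply (is_series_scal_l 18 (fun n => wz_G n 0)), is_series_wz_G.
Qed.
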